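(* Let $W$ be the explicit graph on $40$ vertices defined in the context. Then $\chi(W)=11$ and $\chi^{2}(W\boxtimes K_3)=10$, where $\chi$ denotes the chromatic number and $\chi^{2}$ the $2$-defective chromatic number. Consequently, $C^{\star}\ge C_2\ge \tfrac{11}{10}$, where $C_d=\sup_G \chi(G)/\chi^{d}(G\boxtimes K_{d+1})$ and $C^{\star}=\sup_{d\ge 0}C_d$.
   Context: Graphs are finite, simple and have at least one vertex. For a graph $G$ and an integer $d\ge 0$, the $d$-defective chromatic number $\chi^{d}(G)$ is the least number of parts in a partition of $V(G)$ into sets each inducing a subgraph of maximum degree at most $d$. The $(d+1)$-fold clique blowup $G\boxtimes K_{d+1}$ is the strong product of $G$ with the complete graph $K_{d+1}$: its vertex set is $V(G)\times V(K_{d+1})$, and $(x,i)\sim(y,j)$ iff ($x=y$ and $i\ne j$) or $xy\in E(G)$. For $d\ge 0$ put $C_d=\sup_G \frac{\chi(G)}{\chi^{d}(G\boxtimes K_{d+1})}$ (supremum over all graphs $G$, taken in the extended reals) and $C^{\star}=\sup_{d\ge 0}C_d$. The base graph $B$ has vertex set $\{0,\dots,29\}$ and the following $72$ edges (each pair $u\,w$ denotes the edge $uw$): 0 2, 0 3, 0 4, 0 5, 0 6, 1 2, 1 3, 1 4, 1 5, 1 6, 2 3, 2 4, 2 12, 2 17, 3 4, 5 7, 5 8, 5 9, 6 7, 6 8, 6 9, 7 8, 7 9, 7 22, 7 27, 8 9, 10 12, 10 13, 10 14, 10 15, 10 16, 11 12, 11 13, 11 14, 11 15, 11 16, 12 13,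 12 14, 12 17, 13 14, 15 17, 15 18, 15 19, 16 17, 16 18, 16 19, 17 18, 17 19, 18 19, 20 22, 20 23, 20 24, 20 25, 20 26, 21 22, 21 23, 21 24, 21 25, 21 26, 22 23, 22 24, 22 27, 23 24, 25 27, 25 28, 25 29, 26 27, 26 28, 26 29, 27 28, 27 29, 28 29. The list assignment $L$ assigns to each vertex $v$ of $B$ a $3$-element subset $L(v)$ of $\{0,\dots,9\}$: $L(0)=\{3,4,7\}$, $L(1)=\{3,5,8\}$, $L(2)=\{4,5,9\}$, $L(3)=\{5,7,8\}$, $L(4)=\{4,7,8\}$, $L(5)=\{0,1,3\}$, $L(6)=\{2,3,6\}$, $L(7)=\{0,6,7\}$, $L(8)=\{1,2,6\}$, $L(9)=\{0,1,2\}$, $L(10)=\{3,5,7\}$, $L(11)=\{3,4,6\}$, $L(12)=\{6,7,9\}$, $L(13)=\{4,5,7\}$, $L(14)=\{4,5,6\}$, $L(15)=\{0,1,3\}$, $L(16)=\{2,3,8\}$, $L(17)=\{1,8,9\}$, $L(18)=\{0,2,8\}$, $L(19)=\{0,1,2\}$, $L(20)=\{3,4,5\}$, $L(21)=\{3,6,8\}$, $L(22)=\{5,7,8\}$, $L(23)=\{4,6,8\}$, $L(24)=\{4,5,6\}$, $L(25)=\{0,1,3\}$, $L(26)=\{2,3,9\}$, $L(27)=\{1,7,9\}$, $L(28)=\{0,2,9\}$, $L(29)=\{0,1,2\}$. The graph $W$ has vertex set $V(B)\cup\{z_0,\dots,z_9\}$ (with $z_0,\dots,z_9$ ten new distinct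 vertices) and edge set $$E(W)=E(B)\cup\{z_cz_{c'}: c\ne c'\}\cup\{vz_c: v\in V(B),\ c\in\{0,\dots,9\},\ c\notin L(v)\}.$$ *)

(* Defs.v *)
From mathcomp Require Import all_boot all_order all_algebra.
From mathcomp Require classical_sets reals ereal.

Set Implicit Arguments.
Unset Strict Implicit.
Unset Printing Implicit Defensive.

Record sgraph := SGraph {
  vertex :> finType;
  adj : rel vertex;
  adj_sym : symmetric adj;
  adj_irrefl : irreflexive adj;
  vertex_gt0 : 0 < #|vertex| }.

Section ChromaticNumbers.
Variable G : sgraph.

Definition colorable (k : nat) : bool :=
  [exists f : {ffun G -> 'I_k},
    [forall x, forall y, adj x y ==> (f x != f y)]].

Lemma colorable_ex : exists k, colorable k.
Proof.
exists #|G|; apply/existsP; exists [ffun x => enum_rank x].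
apply/forallP=> x; apply/forallP=> y; apply/implyP=> xy.
rewrite !ffunE (inj_eq enum_rank_inj); apply: contraTneq xy => ->.
by rewrite adj_irrefl.
Qed.

Definition chromatic_number : nat := ex_minn colorable_ex.

Definition max_degree_in (A : {set G}) : nat :=
  \max_(x in A) #|[set y in A | adj x y]|.

Definition defective_partition (d : nat) (P : {set {set G}}) : bool :=
  partition P [set: G] && [forall A in P, max_degree_in A <= d].

Lemma defective_partition_ex (d : nat) :
  exists k, [exists P, defective_partition d P && (#|P| == k)].
Proof.
pose P := preim_partition (@id G) [set: G].
exists #|P|; apply/existsP; exists P; rewrite eqxx andbT /defective_partition.
have partP : partition P [set: G] by exact: preim_partitionP.
rewrite partP; apply/forall_inP => A /imsetP[x _ ->].
apply/bigmax_leqP => y; rewrite !inE => /eqP <-.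
rewrite (_ : [set _ in _ | _] = set0) ?cards0 //.
apply/setP => z; rewrite !inE /=; apply/negP => /andP[/eqP <-].
by rewrite adj_irrefl.
Qed.

Definition defective_chromatic_number (d : nat) : nat := ex_minn (defective_partition_ex d).

End ChromaticNumbers.

(* blowup G d is the strong product of G with K_(d+1), not K_d. *)
Section Blowup.
Variables (G : sgraph) (d : nat).

Definition blowup_adj : rel (G * 'I_d.+1) := fun u v =>
  ((u.1 == v.1) && (u.2 != v.2)) || adj u.1 v.1.

Lemma blowup_adj_sym : symmetric blowup_adj.
Proof.
by move=> u v; rewrite /blowup_adj adj_sym eq_sym [u.2 == _]eq_sym.
Qed.

Lemma blowup_adj_irrefl : irreflexive blowup_adj.
Proof. by move=> u; rewrite /blowup_adj adj_irrefl !eqxx. Qed.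

Lemma blowup_gt0 : 0 < #|{: G * 'I_d.+1}|.
Proof. by rewrite card_prod card_ord muln_gt0 vertex_gt0. Qed.

Definition blowup : sgraph :=
  SGraph blowup_adj_sym blowup_adj_irrefl blowup_gt0.

End Blowup.

Definition B_edges : seq (nat * nat) :=
  [:: (0, 2); (0, 3); (0, 4); (0, 5); (0, 6); (1, 2); (1, 3); (1, 4);
   (1, 5); (1, 6); (2, 3); (2, 4); (2, 12); (2, 17); (3, 4); (5, 7);
   (5, 8); (5, 9); (6, 7); (6, 8); (6, 9); (7, 8); (7, 9); (7, 22);
   (7, 27); (8, 9); (10, 12); (10, 13); (10, 14); (10, 15); (10, 16); (11, 12);
   (11, 13); (11, 14); (11, 15); (11, 16); (12, 13); (12, 14); (12, 17); (13, 14);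
   (15, 17); (15, 18); (15, 19); (16, 17); (16, 18); (16, 19); (17, 18); (17, 19);
   (18, 19); (20, 22); (20, 23); (20, 24); (20, 25); (20, 26); (21, 22); (21, 23);
   (21, 24); (21, 25); (21, 26); (22, 23); (22, 24); (22, 27); (23, 24); (25, 27);
   (25, 28); (25, 29); (26, 27); (26, 28); (26, 29); (27, 28); (27, 29); (28, 29)].

Definition B_adj : rel 'I_30 := fun u v =>
  ((val u, val v) \in B_edges) || ((val v, val u) \in B_edges).

Lemma B_adj_sym : symmetric B_adj.
Proof. by move=> u v; rewrite /B_adj orbC. Qed.

Lemma B_adj_irrefl : irreflexive B_adj.
Proof.
have loopless : all (fun e => e.1 != e.2) B_edges by [].
move=> u; rewrite /B_adj orbb; apply/negP => /(allP loopless) /=.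
by rewrite eqxx.
Qed.

Lemma B_gt0 : 0 < #|{: 'I_30}|.
Proof. by rewrite card_ord. Qed.

Definition B : sgraph := SGraph B_adj_sym B_adj_irrefl B_gt0.

Definition L_table : seq (seq nat) :=
  [:: [:: 3; 4; 7]; [:: 3; 5; 8]; [:: 4; 5; 9]; [:: 5; 7; 8]; [:: 4; 7; 8];
   [:: 0; 1; 3]; [:: 2; 3; 6]; [:: 0; 6; 7]; [:: 1; 2; 6]; [:: 0; 1; 2];
   [:: 3; 5; 7]; [:: 3; 4; 6]; [:: 6; 7; 9]; [:: 4; 5; 7]; [:: 4; 5; 6];
   [:: 0; 1; 3]; [:: 2; 3; 8]; [:: 1; 8; 9]; [:: 0; 2; 8]; [:: 0; 1; 2];
   [:: 3; 4; 5]; [:: 3; 6; 8]; [:: 5; 7; 8]; [:: 4; 6; 8]; [:: 4; 5; 6];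
   [:: 0; 1; 3]; [:: 2; 3; 9]; [:: 1; 7; 9]; [:: 0; 2; 9]; [:: 0; 1; 2]].

Definition L (v : B) : {set 'I_10} :=
  [set c : 'I_10 | val c \in nth [::] L_table (val (v : 'I_30))].

(* inl v is the vertex v of B, and inr c is the new vertex z_c. *)
Definition W_adj : rel (B + 'I_10) := fun u v =>
  match u, v with
  | inl x, inl y => adj x y
  | inr c, inr c' => c != c'
  | inl x, inr c | inr c, inl x => c \notin L x
  end.

Lemma W_adj_sym : symmetric W_adj.
Proof. by case=> [x|c] [y|c'] //=; [exact: B_adj_sym | rewrite eq_sym]. Qed.

Lemma W_adj_irrefl : irreflexive W_adj.
Proof. by case=> [x|c] /=; [exact: B_adj_irrefl | rewrite eqxx]. Qed.

Lemma W_gt0 : 0 < #|{: B + 'I_10}|.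
Proof. by rewrite card_sum !card_ord. Qed.

Definition W : sgraph := SGraph W_adj_sym W_adj_irrefl W_gt0.

Import GRing.Theory.
Import classical_sets reals ereal.
Local Open Scope ring_scope.

(* Both chromatic numbers are positive since graphs are nonempty, so the
   division below is never by zero. *)
Definition C_ (R : realType) (d : nat) : \bar R :=
  ereal_sup [set r : \bar R | exists G : sgraph,
    r = ((chromatic_number G)%:R
         / (defective_chromatic_number (blowup G d) d)%:R : R)%:E]%classic.

Definition Cstar (R : realType) : \bar R := ereal_sup (range (@C_ R)).

(* Main.v *)
Require Import Defs.
From mathcomp Require Import all_boot all_order all_algebra.
From mathcomp Require Import constructive_ereal reals.
From mathcomp Require ereal.

Set Implicit Arguments.
Unset Strict Implicit.
Unset Printing Implicit Defensive.

(** In a 10-colouring of W the clique of the z_c uses every colour once, and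
    naming each colour after the z_c that carries it turns the colouring of B
    into a proper L-colouring.  B consists of three blocks on 10 consecutive
    vertices, and an L-colouring of the first block gives vertex 2 colour 9 or
    vertex 7 colour 7; of the second, vertex 12 or 17 colour 9; of the third,
    vertex 22 or 27 colour 7.  The edges between the blocks, from 2 to 12 and
    17 and from 7 to 22 and 27, make these incompatible, so W is not
    10-colourable.

    For the blowup, give the three copies of z_c colour c and the three copies
    of v the three colours of L(v): this has defect 2 because each vertex v of
    B has, for each c in L(v), at most two neighbours whose list contains c.
    The 30-clique of copies of the z_c meets each part in at most 3 vertices. *)

(** * General bounds on the two chromatic numbers *)

Lemma chromatic_number_eq (G : sgraph) (k : nat) :
  colorable G k -> (forall m, colorable G m -> k <= m) ->
  chromatic_number G = k.
Proof.
move=> Gk lek; rewrite /chromatic_number; case: ex_minnP => m Gm minm.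
by apply/eqP; rewrite eqn_leq minm // lek.
Qed.

(** The nonempty fibres of [F] serve as parts; there is one for each value taken, so at most [k]. *)
Lemma defective_chromatic_number_le (G : sgraph) (k d : nat) (F : G -> 'I_k) :
  (forall x, #|[set y | adj x y && (F y == F x)]| <= d) ->
  defective_chromatic_number G d <= k.
Proof.
move=> defF; rewrite /defective_chromatic_number; case: ex_minnP => m _ minm.
pose P := preim_partition F [set: G].
have partP : partition P [set: G] by exact: preim_partitionP.
apply: (@leq_trans #|P|).
  apply: minm; apply/existsP; exists P; rewrite eqxx andbT.
  rewrite /defective_partition partP; apply/forall_inP => _ /imsetP[x _ ->].
  apply/bigmax_leqP => y; rewrite !inE => /eqP Fxy.
  apply: leq_trans (defF y); apply: subset_leq_card; apply/subsetP => z.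
  by rewrite !inE -Fxy /= andbC eq_sym.
have -> : P = (fun c => [set y | F y == c]) @: (F @: [set: G]).
  rewrite -imset_comp; apply: eq_imset => x /=.
  by apply/setP => y; rewrite !inE eq_sym.
by apply: leq_trans (leq_imset_card _ _) _; rewrite -[leqRHS]card_ord max_card.
Qed.

(** A vertex of [K] in a part [A] is adjacent to all the rest of [K :&: A], so each part holds at
    most [d.+1] vertices of [K]. *)
Lemma card_clique_le_defective_partition (G : sgraph) (d : nat) (K : {set G})
    (P : {set {set G}}) :
  {in K &, forall x y, x != y -> adj x y} -> defective_partition d P ->
  #|K| <= #|P| * d.+1.
Proof.
move=> cliqueK /andP[partP /forall_inP defP].
rewrite -sum_nat_const.
apply: (@leq_trans (\sum_(A in P) #|K :&: A|)).
  rewrite -{1}[K]setIT -(cover_partition partP) big_distrr /=.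
  elim/big_rec2: _ => [|A n U _ IH]; first by rewrite cards0.
  by apply: leq_trans (leq_card_setU _ _) _; rewrite leq_add2l.
apply: leq_sum => A AP; case: (set_0Vmem (K :&: A)) => [->|[x]].
  by rewrite cards0.
rewrite inE => /andP[xK xA].
rewrite (cardsD1 x) inE xK xA ltnS; apply: leq_trans (defP _ AP).
apply: leq_trans (leq_bigmax_cond _ xA).
apply: subset_leq_card; apply/subsetP => y; rewrite !inE.
by case/and3P=> yx yK ->; rewrite cliqueK // eq_sym.
Qed.

(** * Exhaustive search over the list colourings of the blocks of B *)

Section ListColoring.

Variable f : nat -> nat.
Hypothesis f_list : forall v, v < 30 -> f v \in nth [::] L_table v.
Hypothesis f_proper : forall e, e \in B_edges -> f e.1 != f e.2.

(* Conditionals rather than boolean connectives, here and in all_extensions: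
   vm_compute evaluates both arguments of a connective. *)
Definition clash (v c : nat) (s : seq (nat * nat)) : bool :=
  has (fun p => if p.2 == c
    then ((p.1, v) \in B_edges) || ((v, p.1) \in B_edges) else false) s.

Fixpoint all_extensions (P : pred (seq (nat * nat))) vs s : bool :=
  if vs is v :: vs' then
    all (fun c => if clash v c s then true
                  else all_extensions P vs' ((v, c) :: s))
      (nth [::] L_table v)
  else P s.

(** The values of [f] follow one branch of the search, and properness of [f] ensures that this
    branch is never pruned by [clash]. *)
Lemma all_extensionsP P vs s :
  all (gtn 30) vs -> all_extensions P vs [seq (v, f v) | v <- s] ->
  P [seq (v, f v) | v <- catrev vs s].
Proof.
elim: vs s => [//|v vs IH] s /= /andP[v30 vs30] /allP/(_ _ (f_list v30)).
case: ifP => [|_ /(IH (v :: s) vs30) //].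
case/hasP=> _ /mapP[u _ ->] /=; case: eqP => // fuv uv _; move: uv.
by case/orP => /f_proper /=; rewrite fuv eqxx.
Qed.

Lemma block_colored a b c d k :
  k <= 20 -> all_extensions (fun s => ((a, c) \in s) || ((b, d) \in s))
    (iota k 10) [::] ->
  (f a == c) || (f b == d).
Proof.
move=> k20 /(@all_extensionsP _ _ [::]).
have -> : all (gtn 30) (iota k 10).
  apply/allP => v; rewrite mem_iota /= => /andP[_ vk].
  by apply: leq_trans vk _; rewrite -[30]/(20 + 10) leq_add2r.
by move=> /(_ isT) /orP[] /mapP[v _ [-> ->]]; rewrite eqxx ?orbT.
Qed.

Lemma no_list_coloring : False.
Proof.
have b0 : (f 2 == 9) || (f 7 == 7).
  by apply: (@block_colored _ _ _ _ 0); vm_compute.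
have b1 : (f 12 == 9) || (f 17 == 9).
  by apply: (@block_colored _ _ _ _ 10); vm_compute.
have b2 : (f 22 == 7) || (f 27 == 7).
  by apply: (@block_colored _ _ _ _ 20); vm_compute.
have e1 : f 2 != f 12 by apply: (f_proper (e := (2, 12))).
have e2 : f 2 != f 17 by apply: (f_proper (e := (2, 17))).
have e3 : f 7 != f 22 by apply: (f_proper (e := (7, 22))).
have e4 : f 7 != f 27 by apply: (f_proper (e := (7, 27))).
case/orP: b0 => /eqP fE; move: e1 e2 e3 e4; rewrite fE => e1 e2 e3 e4.
  by case/orP: b1 => /eqP fE'; rewrite fE' in e1 e2.
by case/orP: b2 => /eqP fE'; rewrite fE' in e3 e4.
Qed.

End ListColoring.

(** * The chromatic number of W *)

Lemma B_edges_lt30 e : e \in B_edges -> (e.1 < 30) && (e.2 < 30).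
Proof. by move: e; apply/allP. Qed.

Lemma W_colorable_ge11 m : colorable W m -> 11 <= m.
Proof.
case/existsP=> g /forallP g_proper.
have gP (x y : W) : adj x y -> g x != g y.
  by move/forallP: (g_proper x) => /(_ y) /implyP.
rewrite ltnNge; apply/negP => m10.
pose h (c : 'I_10) := g (inr c : W).
have h_inj : injective h.
  move=> c c' /eqP hcc'; apply/eqP; apply: contraLR hcc' => cc'.
  exact: (gP (inr c : W) (inr c' : W)).
(* Here [m <= 10] enters: an injection from ten colours into [m] is onto. *)
have h_onto y : y \in codom h by apply: inj_card_onto; rewrite ?card_ord.
pose f v := val (iinv (h_onto (g (inl (inord v : 'I_30) : W)))).
have vinord v : v < 30 -> val (inord v : 'I_30) = v := @inordK 29 v.
have hf v (c : 'I_10) : f v = val c -> g (inl (inord v : 'I_30) : W) = h c.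
  by move/val_inj <-; rewrite f_iinv.
apply: (@no_list_coloring f) => [v v30|[u v] /= uv].
  (* If [f v] were outside the list of [v], then [v] would be adjacent to the z-vertex that shares
     its colour. *)
  apply: contraT => vL.
  have [c fc] : exists c : 'I_10, f v = val c by eexists; reflexivity.
  have := gP (inl (inord v : 'I_30)) (inr c).
  by rewrite (hf _ _ fc) eqxx /= /L inE vinord // -fc vL => /(_ isT).
have /andP[/= u30 v30] := B_edges_lt30 uv.
have [c fc] : exists c : 'I_10, f v = val c by eexists; reflexivity.
apply/negP => /eqP fuv.
have := gP (inl (inord u : 'I_30)) (inl (inord v : 'I_30)).
rewrite (hf _ _ fc) (hf u c) ?fuv // eqxx /= /B_adj !vinord // uv.
by move=> /(_ isT).
Qed.

(* A colouring of B from the lists except that vertex 0 gets the new colour. *)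
Definition B_coloring : seq nat :=
  [:: 10; 5; 4; 7; 8; 0; 3; 6; 1; 2; 3; 3; 6; 5; 4; 0; 2; 9; 8; 1; 3; 3; 5; 6;
   4; 0; 2; 7; 9; 1].

Lemma W_colorable11 : colorable W 11.
Proof.
pose g (x : W) : 'I_11 :=
  match x with
  | inl v => inord (nth 0 B_coloring (val (v : 'I_30)))
  | inr c => inord c
  end.
have lt11 (i : nat) : nth 0 B_coloring i < 11.
  have [i30|i30] := ltnP i (size B_coloring); last by rewrite nth_default.
  have /all_nthP lt11 : all (gtn 11) B_coloring by [].
  exact: lt11.
have proper : all (fun e => nth 0 B_coloring e.1 != nth 0 B_coloring e.2)
    B_edges by [].
have lists : all (fun v => nth 0 B_coloring v \in 10 :: nth [::] L_table v)
    (iota 0 30) by [].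
have lt_c (c : 'I_10) : c < 11 by apply: ltn_trans (ltn_ord c) _.
have vz (v : 'I_30) (c : 'I_10) : c \notin L v ->
    g (inl v : W) != g (inr c : W).
  move=> cL; rewrite -val_eqE /= !inordK ?lt11 ?lt_c //.
  have := allP lists v; rewrite mem_iota ltn_ord => /(_ isT).
  (* The colour 10 occurs on no z-vertex. *)
  rewrite inE => /orP[/eqP->|vL]; first by rewrite neq_ltn ltn_ord orbT.
  by apply: contraNneq cL => vc; rewrite /L inE -[\val c]/(nat_of_ord c) -vc.
apply/existsP; exists [ffun x => g x]; apply/forallP => x; apply/forallP => y.
apply/implyP; rewrite !ffunE; case: x y => [x|c] [y|c'] /=.
- move=> xy; rewrite -val_eqE /= !inordK ?lt11 //.
  by case/orP: xy => /(allP proper) //=; rewrite eq_sym.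
- exact: vz.
- by rewrite eq_sym; apply: vz.
- by move=> cc'; rewrite -val_eqE /= !inordK ?lt_c.
Qed.

Lemma chromatic_number_W : chromatic_number W = 11.
Proof. exact: chromatic_number_eq W_colorable11 W_colorable_ge11. Qed.

(** * The 2-defective chromatic number of the blowup *)

Lemma lists_uniq (v : 'I_30) :
  uniq (nth [::] L_table v) && (size (nth [::] L_table v) == 3).
Proof.
have /allP : all (fun i => uniq (nth [::] L_table i)
  && (size (nth [::] L_table i) == 3)) (iota 0 30) by [].
by apply; rewrite mem_iota ltn_ord.
Qed.

Lemma lists_lt10 (v : 'I_30) (i : nat) : nth 0 (nth [::] L_table v) i < 10.
Proof.
have [ilt|ige] := ltnP i (size (nth [::] L_table v)); last first.
  by rewrite nth_default.
have /allP/(_ v) : all (fun i => all (gtn 10) (nth [::] L_table i)) (iota 0 30).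
  by [].
by rewrite mem_iota ltn_ord => /(_ isT) /(all_nthP 0); apply.
Qed.

Lemma same_color_neighbors (x : 'I_30) (c : nat) :
  c \in nth [::] L_table x ->
  count (fun y : 'I_30 => B_adj x y && (c \in nth [::] L_table y))
    (enum 'I_30) <= 2.
Proof.
move=> cx.
have /allP/(_ x) : all (fun u => all (fun c => count (fun w =>
    (((u, w) \in B_edges) || ((w, u) \in B_edges))
      && (c \in nth [::] L_table w)) (iota 0 30) <= 2) (nth [::] L_table u))
  (iota 0 30) by vm_compute.
rewrite mem_iota ltn_ord => /(_ isT) /allP /(_ c cx).
by rewrite -val_enum_ord count_map.
Qed.

Lemma defective_chromatic_number_le10 :
  defective_chromatic_number (blowup W 2) 2 <= 10.
Proof.
pose F (u : blowup W 2) : 'I_10 :=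
  match (u : W * 'I_3).1 with
  | inl v => inord (nth 0 (nth [::] L_table (val (v : 'I_30))) u.2)
  | inr c => c
  end.
have FE (v : 'I_30) (j : 'I_3) :
    val (F (inl v : W, j)) = nth 0 (nth [::] L_table v) j.
  by rewrite /= inordK ?lists_lt10.
have FL (v : 'I_30) (j : 'I_3) :
    val (F (inl v : W, j)) \in nth [::] L_table v.
  by rewrite FE mem_nth //; case/andP: (lists_uniq v) => _ /eqP->.
apply: (@defective_chromatic_number_le _ _ _ F) => -[[x|c] i].
- pose c := F (inl x, i).
  (* A neighbour [y] with [c] in its list has exactly one copy coloured [c], indexed by the position
     of [c] in that list. The other copies of [x] have other colours, and [z_c] is not adjacent to
     [x]. *)
  pose s := [seq ((inl y,
      inord (index (val c) (nth [::] L_table (val y)))) : W * 'I_3)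
    | y <- enum 'I_30 & B_adj x y && (val c \in nth [::] L_table (val y))].
  apply: (@leq_trans (size s)); last first.
    by rewrite size_map size_filter; apply: same_color_neighbors; apply: FL.
  apply: leq_trans (card_size _); apply: subset_leq_card; apply/subsetP.
  case=> [[y|c'] j]; rewrite inE;
    case/andP=> /orP[/andP[/eqP /= Exy ij]|/= xy] /eqP Fxy //.
  + case: Exy Fxy => <- Fxy; case/eqP: ij; apply: val_inj.
    have /andP[un /eqP sz] := lists_uniq x.
    have /eqP := congr1 val Fxy; rewrite !FE nth_uniq ?sz //.
    by move/eqP/esym.
  + have Fc : val c = val (F (inl y, j)) by rewrite Fxy.
    have /andP[un /eqP sz] := lists_uniq y.
    apply/mapP; exists y.
      by rewrite mem_filter mem_enum andbT xy Fc FL.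
    by congr (_, _); apply/val_inj; rewrite /= Fc FE index_uniq ?sz // inordK.
  + by case/negP: xy; rewrite /L inE; have := FL x i; rewrite -Fxy.
(* A copy of a vertex of B coloured [c] has [c] in its list, hence is not adjacent to [z_c]; only
   the two other copies of [z_c] remain. *)
- have sub : [set y | adj ((inr c, i) : blowup W 2) y && (F y == F (inr c, i))]
      \subset [set (inr c : W, j) | j in [set~ i]].
    apply/subsetP => -[[y|c'] j]; rewrite inE /= => /andP[/= cy /eqP Fy].
      by case/negP: cy; rewrite /L inE; have := FL y j; rewrite Fy.
    have {Fy} c'c : c' = c by exact: Fy.
    move: cy; rewrite c'c /blowup_adj /= !eqxx orbF => ij.
    by apply: imset_f; rewrite !inE eq_sym.
  apply: leq_trans (subset_leq_card sub) _.
  by apply: leq_trans (leq_imset_card _ _) _; rewrite cardsC1 card_ord.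
Qed.

Lemma defective_chromatic_number_ge10 :
  10 <= defective_chromatic_number (blowup W 2) 2.
Proof.
rewrite /defective_chromatic_number; case: ex_minnP => m /existsP[P].
case/andP=> defP /eqP <- _.
pose z (p : 'I_10 * 'I_3) : blowup W 2 := (inr p.1 : W, p.2).
have z_inj : injective z by case=> [c i] [c' i'] [-> ->].
(* The factor 3 is [d.+1], so the clique bound to apply is [30 <= #|P| * 3]. *)
rewrite -(@leq_pmul2r 3) //.
apply: leq_trans (card_clique_le_defective_partition (K := z @: setT) _ defP).
  by rewrite card_imset // cardsT card_prod !card_ord.
move=> _ _ /imsetP[[c i] _ ->] /imsetP[[c' i'] _ ->].
rewrite (inj_eq z_inj) /= /blowup_adj /=.
have [->|//] := eqVneq c c'; last by rewrite orbT.
by rewrite xpair_eqE !eqxx /= orbF.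
Qed.

Lemma defective_chromatic_number_W :
  defective_chromatic_number (blowup W 2) 2 = 10.
Proof.
apply/eqP; rewrite eqn_leq defective_chromatic_number_le10.
exact: defective_chromatic_number_ge10.
Qed.

Theorem theorem1 (R : realType) :
  [/\ chromatic_number W = 11%N,
      defective_chromatic_number (blowup W 2) 2 = 10%N,
      (C_ R 2 <= Cstar R)%E
    & ((11%:R / 10%:R : R)%R%:E <= C_ R 2)%E].
Proof.
split.
- exact: chromatic_number_W.
- exact: defective_chromatic_number_W.
- by apply: ereal.ereal_sup_ubound; exists 2.
- apply: ereal.ereal_sup_ubound; exists W.
  by rewrite chromatic_number_W defective_chromatic_number_W.
Qed.
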